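(* Let $d\ge 1$ be an integer. The function $N\mapsto g_d(N)$, $N\in\mathbb{Z}_{\ge 0}$, is a polynomial in $N$ of degree $2d-2$.
   Context: Let $[d]=\{1,\dots,d\}$. A matrix $A\in\mathbb{R}^{d\times d}$ is a $G$-matrix of value $N\in\mathbb{R}_{\ge 0}$ if all its entries are nonnegative and $A_{1,\sigma(1)}+A_{2,\sigma(2)}+\cdots+A_{d,\sigma(d)}=N$ for every permutation $\sigma$ of $[d]$. For $N\in\mathbb{Z}_{\ge 0}$, $g_d(N)$ denotes the number of $d\times d$ $G$-matrices of value $N$ all of whose entries are integers. *)

(* Defs.v *)
From HB Require Import structures.
From mathcomp Require Import all_boot all_order all_algebra all_fingroup.
From mathcomp Require Import finmap.
From mathcomp Require Import boolp classical_sets cardinality reals.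
Set Implicit Arguments.
Unset Strict Implicit.
Unset Printing Implicit Defensive.
Import Order.TTheory GRing.Theory Num.Theory.
Local Open Scope classical_set_scope.
Local Open Scope ring_scope.

(* The value [N] need not be assumed nonnegative: it is a sum of entries. *)
Definition is_Gmatrix (R : realType) (d : nat) (N : R) (A : 'M[R]_d) : Prop :=
  (forall i j, 0 <= A i j) /\ (forall s : 'S_d, \sum_i A i (s i) = N).

Definition int_Gmatrices (R : realType) (d N : nat) : set 'M[R]_d :=
  [set A | is_Gmatrix N%:R A /\ forall i j, A i j \is a Num.int].
Arguments int_Gmatrices : clear implicits.

(* [fset_set] sends infinite sets to the empty one, so this is a genuine count
   only together with the finiteness of [int_Gmatrices R d N]. *)
Definition g (R : realType) (d N : nat) : nat :=
  #|` fset_set (int_Gmatrices R d N) |%fset.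

(* Main.v *)
Require Import Defs.
From HB Require Import structures.
From mathcomp Require Import all_boot all_order all_algebra all_fingroup.
From mathcomp Require Import finmap.
From mathcomp Require Import boolp classical_sets cardinality reals.
From mathcomp Require Import zify.
Set Implicit Arguments.
Unset Strict Implicit.
Unset Printing Implicit Defensive.
Import Order.TTheory GRing.Theory Num.Theory.
Local Open Scope classical_set_scope.
Local Open Scope ring_scope.

(* Comparing the permutations [s] and [(i k) s] gives
    [A i j + A k l = A i l + A k j], so an integer G-matrix has the form
    [a i + b j]; it is so in exactly one way with [a, b >= 0] and [min a = 0].
    Then [\sum a + \sum b = N], so with [d = n + 1] we are counting the weak
    compositions of [N] into [2d] parts whose first [d] parts are not all
    positive: there are [C(N+2n+1, 2n+1) - C(N+n, 2n+1)] of them. By Pascal's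
    rule this is the sum of the [C(N+n+k, 2n)] over [k <= n], each of which is
    a polynomial in [N] with leading term [N^(2n) / (2n)!]. *)

(** * Exchange relation between the entries of a G-matrix *)

Lemma perm_2points (T : finType) (i k j l : T) :
  i != k -> j != l -> exists s : {perm T}, s i = j /\ s k = l.
Proof.
(* The first transposition sends [i] to [j] and [k] to some point other than [j]; the second moves
   that point to [l] and fixes [j]. *)
move=> ik jl; exists (tperm i j * tperm (tperm i j k) l)%g.
rewrite !permM tpermL; split; last by rewrite tpermL.
rewrite tpermD ?[l == j]eq_sym //.
by rewrite -{2}(tpermL i j) (inj_eq perm_inj) eq_sym.
Qed.

Lemma Gmatrix_exchange (R : realType) d (N : R) (A : 'M[R]_d) i j k l :
  is_Gmatrix N A -> A i j + A k l = A i l + A k j.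
Proof.
move=> [_ AN]; have [->|ik] := eqVneq i k; first by rewrite addrC.
have [->//|jl] := eqVneq j l.
have [s [sij skl]] := perm_2points ik jl.
have := AN (tperm i k * s)%g; rewrite -(AN s).
rewrite (bigD1 i) //= (bigD1 k) /=; last by rewrite eq_sym.
rewrite [RHS](bigD1 i) //= [X in _ = _ + X](bigD1 k) /=; last by rewrite eq_sym.
rewrite !permM tpermL tpermR sij skl !addrA => e.
apply/esym; apply: (addIr _ (etrans e _)); congr (_ + _).
apply: eq_bigr => x /andP[xi xk].
by rewrite permM tpermD // eq_sym.
Qed.

(** * Weak compositions of [N] into [2n + 2] parts *)

Section Compositions.
Variable n : nat.

(** No part of a composition of [N] exceeds [N], so the bound in ['I_N.+1] loses nothing; it makes
    the set finite and ready for stars and bars. *)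
Definition compositions N : {set (n.+1 + n.+1).-tuple 'I_N.+1} :=
  [set t : (n.+1 + n.+1).-tuple 'I_N.+1 | (\sum_(i <- t) i == N)%N].

Definition lpart N (t : (n.+1 + n.+1).-tuple 'I_N.+1) i : nat :=
  tnth t (lshift n.+1 i).
Definition rpart N (t : (n.+1 + n.+1).-tuple 'I_N.+1) i : nat :=
  tnth t (rshift n.+1 i).

Definition normal_compositions N :=
  [set t in compositions N | [exists i, lpart t i == 0%N]].

Lemma compositionsE N (t : (n.+1 + n.+1).-tuple 'I_N.+1) :
  (t \in compositions N) = (\sum_i lpart t i + \sum_i rpart t i == N)%N.
Proof. by rewrite inE big_tuple big_split_ord. Qed.

Lemma parts_inj N (t u : (n.+1 + n.+1).-tuple 'I_N.+1) :
  lpart t =1 lpart u -> rpart t =1 rpart u -> t = u.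
Proof.
move=> l r; apply: eq_from_tnth => i; apply: val_inj.
by case: (split_ordP i) => j ->; [apply: l | apply: r].
Qed.

Lemma composition_of_parts N (a b : 'I_n.+1 -> nat) :
  (\sum_i a i + \sum_i b i = N)%N ->
  exists t : (n.+1 + n.+1).-tuple 'I_N.+1,
    [/\ t \in compositions N, lpart t =1 a & rpart t =1 b].
Proof.
move=> abN.
have le_sum (c : 'I_n.+1 -> nat) i : (c i <= \sum_i c i)%N.
  by rewrite (bigD1 i) //= leq_addr.
pose t := [tuple inord (match split i with inl j => a j | inr j => b j end)
            : 'I_N.+1 | i < (n.+1 + n.+1)].
have ta : lpart t =1 a.
  move=> i; rewrite /lpart tnth_mktuple -/(unsplit (inl i)) unsplitK inordK //.
  by have := le_sum a i; lia.
have tb : rpart t =1 b.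
  move=> i; rewrite /rpart tnth_mktuple -/(unsplit (inr i)) unsplitK inordK //.
  by have := le_sum b i; lia.
exists t; split => //; rewrite compositionsE.
by rewrite (eq_bigr _ (fun i _ => ta i)) (eq_bigr _ (fun i _ => tb i)) abN.
Qed.

(** Stars and bars applies directly, because [n.+1 + n.+1] is convertible to [(n + n.+1).+1]. *)
Lemma card_compositions N : #|compositions N| = 'C(n + n.+1 + N, n + n.+1).
Proof. exact: card_ord_partitions. Qed.

(* By the bijection subtracting 1 from each of the first [n.+1] parts. *)
Lemma card_positive_compositions N :
  #|compositions N :\: normal_compositions N| = 'C(N + n, n + n.+1).
Proof.
have pos t : (t \in compositions N :\: normal_compositions N) =
    (t \in compositions N) && [forall i, 0 < lpart t i]%N.
  rewrite !inE; case: eqP => //= _; rewrite andbT negb_exists.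
  by apply: eq_forallb => i; rewrite lt0n.
have sum1 : (\sum_(i < n.+1) 1 = n.+1)%N by rewrite sum1_card card_ord.
(* For [N <= n], [n.+1] positive parts already sum to more than [N], and the binomial vanishes;
   otherwise the subtraction [N - n.+1] is exact. *)
have [ltNn|leSnN] := ltnP N n.+1.
  rewrite bin_small; last by lia.
  apply: eq_card0 => t; rewrite pos compositionsE.
  apply/negP => /andP[/eqP tN /forallP t_gt0].
  have : (\sum_(i < n.+1) 1 <= \sum_i lpart t i)%N.
    by apply: leq_sum => i _; apply: t_gt0.
  by rewrite sum1; lia.
have -> : (N + n = n + n.+1 + (N - n.+1))%N by lia.
rewrite -card_compositions.
(* The implication sits under the existential so that [choice] yields a total function; outside
   [compositions] the zero tuple is a dummy value. *)
have lift (u : (n.+1 + n.+1).-tuple 'I_(N - n.+1).+1) :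
    exists t : (n.+1 + n.+1).-tuple 'I_N.+1, u \in compositions (N - n.+1) ->
    [/\ t \in compositions N, lpart t =1 (fun i => (lpart u i).+1)
      & rpart t =1 rpart u].
  have [uN|_] := boolP (u \in _); last by exists [tuple ord0 | _ < _].
  have [|t ht] := @composition_of_parts N (fun i => (lpart u i).+1) (rpart u).
    under eq_bigr do rewrite -addn1.
    rewrite big_split /= sum1.
    by move: uN; rewrite compositionsE addnAC => /eqP->; rewrite subnK.
  by exists t.
have [f fP] := choice lift.
rewrite -(@card_in_imset _ _ f) => [|u v /fP[_ ul ur] /fP[_ vl vr] fuv].
  apply: eq_card => t; rewrite pos; apply/andP/imsetP => [[tN /forallP t0]|].
    have [|u [uN ul ur]] :=
        @composition_of_parts (N - n.+1) (fun i => (lpart t i).-1) (rpart t).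
      have sum_pred : (\sum_i lpart t i = \sum_i (lpart t i).-1 + n.+1)%N.
        rewrite -[X in (_ + X)%N]sum1 -big_split.
        by apply: eq_bigr => i _; rewrite /= addn1 prednK // t0.
      apply/eqP; rewrite -(eqn_add2r n.+1) subnK // addnAC -sum_pred.
      by rewrite -compositionsE.
    exists u => //; have [_ fl fr] := fP _ uN.
    apply: parts_inj => i; last by rewrite fr ur.
    by rewrite fl ul prednK // t0.
  move=> [u /fP[fN fl _] ->]; split=> //.
  by apply/forallP => i; rewrite fl.
apply: parts_inj => i; last by rewrite -ur fuv vr.
by have := ul i; rewrite fuv vl => -[].
Qed.

Lemma card_normal_compositions N :
  #|normal_compositions N| = (\sum_(k < n.+1) 'C(N + (n + k), n + n))%N.
Proof.
have sub : normal_compositions N \subset compositions N.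
  by apply/fintype.subsetP => t; rewrite inE => /andP[].
have := cardsD (compositions N) (normal_compositions N).
have := subset_leq_card sub.
rewrite (finset.setIidPr sub) card_positive_compositions card_compositions.
suff -> : 'C(n + n.+1 + N, n + n.+1) =
    ('C(N + n, n + n.+1) + \sum_(k < n.+1) 'C(N + (n + k), n + n))%N by lia.
have -> : (n + n.+1 + N = N + n + n.+1)%N by lia.
have pascal m : ('C(N + n + m, n + n.+1) =
    'C(N + n, n + n.+1) + \sum_(k < m) 'C(N + (n + k), n + n))%N.
  elim: m => [|m IH]; first by rewrite big_ord0 !addn0.
  by rewrite big_ord_recr /= addnA -IH !addnS binS !addnA.
exact: pascal.
Qed.

(** * Integer G-matrices as normal compositions *)

Variable R : realType.

Definition Gmatrix_of N (t : (n.+1 + n.+1).-tuple 'I_N.+1) : 'M[R]_n.+1 :=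
  \matrix_(i, j) (lpart t i + rpart t j)%:R.

Lemma Gmatrix_of_inj N :
  {in normal_compositions N &, injective (@Gmatrix_of N)}.
Proof.
move=> t u.
rewrite inE => /andP[_ /existsP[i /eqP ti]].
rewrite inE => /andP[_ /existsP[k /eqP uk]].
move=> /matrixP e.
have {}e x y : (lpart t x + rpart t y = lpart u x + rpart u y)%N.
  by have := e x y; rewrite !mxE => /eqP; rewrite eqr_nat => /eqP.
(* Row [i], where [t] has a zero, gives [rpart u y <= rpart t y]; row [k], where [u] has one, gives
   the converse. *)
have r y : rpart t y = rpart u y.
  by have := e i y; have := e k y; lia.
by apply: parts_inj => // x; have := e x ord0; rewrite r; lia.
Qed.

Lemma Gmatrix_of_int N t :
  t \in compositions N -> int_Gmatrices R n.+1 N (Gmatrix_of t).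
Proof.
rewrite compositionsE => /eqP tN; split; last first.
  by move=> i j; rewrite mxE; apply: intr_nat.
split=> [i j|s]; first by rewrite mxE ler0n.
under eq_bigr do rewrite mxE.
rewrite -natr_sum big_split /= -[in RHS]tN; congr (_ + _)%:R.
by rewrite [RHS](reindex_inj (@perm_inj _ s)).
Qed.

Lemma int_Gmatrix_normal_form N (A : 'M[R]_n.+1) :
  int_Gmatrices R n.+1 N A ->
  exists2 t, t \in normal_compositions N & Gmatrix_of t = A.
Proof.
move=> [GA Aint]; have [A0 AN] := GA.
have Anat i j : exists m : nat, A i j = m%:R.
  by apply/natrP; rewrite natrEint Aint A0.
have [B BE] := choice (fun i => ex_intro _ _ (projT2 (choice (Anat i)))).
have exch i j k l : (B i j + B k l = B i l + B k j)%N.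
  apply/eqP; rewrite -(eqr_nat R) !natrD -!BE.
  by apply/eqP; apply: Gmatrix_exchange GA.
have [i0 _ i0min] := arg_minnP (P := xpredT) (fun i => B i ord0) (i0 := ord0) isT.
(* Take [b] to be row [i0] and [a] the excess of column [ord0] over its minimum, so that [a i0 = 0].
   By exchange [a i + b i] is the diagonal entry [B i i], so the parts add up to the sum along the
   identity permutation, which is [N]. *)
have [|t [tN tl tr]] :=
    @composition_of_parts N (fun i => B i ord0 - B i0 ord0)%N (B i0).
  apply/eqP; rewrite -(eqr_nat R) -(AN 1%g) -big_split /= natr_sum.
  apply/eqP; apply: eq_bigr => i _; rewrite perm1 BE; congr _%:R.
  by have := i0min i isT; have := exch i i i0 ord0; lia.
exists t.
  by rewrite inE tN; apply/existsP; exists i0; rewrite tl subnn.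
apply/matrixP => i j; rewrite mxE BE tl tr; congr _%:R.
by have := i0min i isT; have := exch i j i0 ord0; lia.
Qed.

Lemma int_GmatricesE N :
  int_Gmatrices R n.+1 N = @Gmatrix_of N @` [set` normal_compositions N].
Proof.
apply/seteqP; split=> A /= => [/int_Gmatrix_normal_form[t tN tA]|[t + <-]].
  by exists t.
by rewrite inE => /andP[/Gmatrix_of_int].
Qed.

Lemma finite_int_Gmatrices N : finite_set (int_Gmatrices R n.+1 N).
Proof. by rewrite int_GmatricesE; apply/finite_image/finite_finset. Qed.

Lemma gE N : g R n.+1 N = (\sum_(k < n.+1) 'C(N + (n + k), n + n))%N.
Proof.
rewrite -card_normal_compositions /g.
rewrite (_ : fset_set _ = [fset Gmatrix_of t | t in normal_compositions N]%fset).
  by rewrite card_in_imfset ?cardE //; apply: Gmatrix_of_inj.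
apply/fsetP => A; rewrite in_fset_set ?int_GmatricesE; last first.
  by rewrite -int_GmatricesE; apply: finite_int_Gmatrices.
by apply/idP/imfsetP => [/set_mem[t tN <-]|[t tN ->]];
  [exists t | apply/mem_set; exists t].
Qed.

End Compositions.

(** * Polynomiality and degree *)

Lemma natr_ffact (R : nzRingType) m k :
  (m ^_ k)%:R = \prod_(i < k) (m%:R - i%:R) :> R.
Proof.
elim: k => [|k IH]; first by rewrite big_ord0.
rewrite ffactnSr natrM big_ord_recr /= -IH.
(* Truncated and ring subtraction differ only when [m < k], and there the factor [m ^_ k] is already
   zero. *)
have [le_km|lt_mk] := leqP k m; first by rewrite natrB.
by rewrite ffact_small // !mul0r.
Qed.

(** The falling factorial of ['X + s] with [m] factors, written through its roots [i - s] so that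
    the lemmas on products of ['X - c%:P] give monicity and size. *)
Definition shifted_ffact_poly (m s : nat) : {poly rat} :=
  \prod_(i < m) ('X - (i%:R - s%:R)%:P).

Lemma horner_shifted_ffact_poly m s N :
  (shifted_ffact_poly m s).[N%:R] = ((N + s) ^_ m)%:R.
Proof.
rewrite natr_ffact horner_prod; apply: eq_bigr => i _.
by rewrite hornerXsubC natrD opprB addrCA addrA [_ + N%:R]addrC.
Qed.

(** The top terms cannot cancel: the coefficient of degree [m] in the sum is [q.+1], which is
    nonzero in a [numDomainType]. *)
Lemma size_sum_monic (R : numDomainType) (q m : nat) (F : 'I_q.+1 -> {poly R}) :
  (forall k, F k \is monic) -> (forall k, size (F k) = m.+1) ->
  size (\sum_k F k) = m.+1.
Proof.
move=> Fmon Fsize; apply/eqP; rewrite eqn_leq; apply/andP; split.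
  apply: (leq_trans (size_sum _ _ _)).
  by apply/bigmax_leqP => k _; rewrite Fsize.
rewrite ltnNge; apply/negP => /leq_sizeP/(_ m (leqnn m)).
rewrite coef_sum (eq_bigr (fun=> 1)) => [|k _].
  by rewrite sumr_const card_ord => /eqP; rewrite pnatr_eq0.
by have /monicP := Fmon k; rewrite /lead_coef Fsize.
Qed.

Theorem mainTheorem2 (R : realType) (d : nat) (hd : (1 <= d)%N) :
  (forall N : nat, finite_set (int_Gmatrices R d N)) /\
  exists p : {poly rat},
    size p = (2 * d - 2).+1 /\ forall N : nat, (g R d N)%:R = p.[N%:R].
Proof.
case: d hd => // n _; split; first exact: finite_int_Gmatrices.
have fact_neq0 : ((n + n)`!)%:R != 0 :> rat by rewrite pnatr_eq0 -lt0n fact_gt0.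
(* Each binomial in [gE] is a falling factorial of [N + (n + k)] with [n + n] factors, divided by
   [(n + n)!]. *)
exists ((n + n)`!%:R^-1 *: \sum_(k < n.+1) shifted_ffact_poly (n + n) (n + k)).
split=> [|N].
  rewrite size_scale ?invr_eq0 //.
  have -> : (2 * n.+1 - 2 = n + n)%N by lia.
  apply: size_sum_monic => k; first exact: monic_prod_XsubC.
  by rewrite /shifted_ffact_poly size_prod_XsubC /index_enum -enumT size_enum_ord.
rewrite gE hornerZ horner_sum natr_sum mulr_sumr; apply: eq_bigr => k _.
by rewrite horner_shifted_ffact_poly -bin_ffact natrM mulrC mulfK.
Qed.
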